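(* Let $X=\{F=0\}$ and $\mathcal Q=\{q=0\}$ be smooth quadric hypersurfaces in $\mathbb P^N=\mathbb P(V)$ such that the symmetric matrices $M_F$ and $M_Q$ associated with $F$ and with $q$ are real, and assume that $M_Q$ is positive definite. Let $Q$ be the symmetric bilinear form with matrix $M_Q$. Then $$\mathrm{EDdegree}_Q(X)=2(r-1),$$ where $r$ is the number of distinct eigenvalues of $M_Q^{-1}M_F$.
   Context: $V\cong\mathbb C^{N+1}$ with real part $V^{\mathbb R}\cong\mathbb R^{N+1}$; $F$ and $q$ are quadratic forms and $q(x)=Q(x,x)$, where $Q$ is extended complex bilinearly to $V$. Let $CX\subset V$ be the affine cone over $X$. For $x\in(CX)_{\mathrm{sm}}$ put $N_xCX=\{v^*\in V: Q(v^*,v)=0\ \forall v\in T_xCX\}$. The ED correspondence $\mathcal E(X,Q)$ is the Zariski closure in $V\times V$ of $\{(x,u): x\in(CX)_{\mathrm{sm}},\ u-x\in N_xCX\}$, and $\mathrm{EDdegree}_Q(X)$ is the cardinality of the fiber of the second projection $\mathcal E(X,Q)\to V$ over a general $u\in V$ (equal to $0$ if this projection is not dominant), i.e. the number of complex critical points of $x\mapsto q(u-x)$ on $(CX)_{\mathrm{sm}}$. *)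

(* Defs.v *)
From mathcomp Require Import all_boot all_order all_algebra.
From mathcomp Require Import complex mpoly.
From mathcomp Require Import reals.

Set Implicit Arguments.
Unset Strict Implicit.
Unset Printing Implicit Defensive.

Import Order.TTheory GRing.Theory Num.Theory.
Local Open Scope ring_scope.

Definition has_card (T : eqType) (A : T -> Prop) (k : nat) : Prop :=
  exists s : seq T, [/\ uniq s, size s = k & forall x, x \in s <-> A x].

Section AffineGeometry.
Variables (K : fieldType) (n : nat).
Implicit Types (p : {mpoly K[n]}) (Z : 'cV[K]_n -> Prop) (x v : 'cV[K]_n).

Definition peval p x : K := p.@[fun i => x i 0].

Definition vanishes_on p Z : Prop := forall x, Z x -> peval p x = 0.

Definition zclosure Z : 'cV[K]_n -> Prop :=
  fun y => forall p, vanishes_on p Z -> peval p y = 0.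

(* [P] holds on a nonempty Zariski open subset of affine space. *)
Definition generically (P : 'cV[K]_n -> Prop) : Prop :=
  exists2 p : {mpoly K[n]}, p != 0 & forall u, peval p u != 0 -> P u.

Definition gradient p x : 'rV[K]_n := \row_i peval p^`M(i) x.

(* Zariski tangent space, as a linear subspace, of the reduced closed set [Z]:
   all polynomials vanishing on [Z] are used, not a chosen set of equations. *)
Definition tangent Z x : 'cV[K]_n -> Prop :=
  fun v => forall p, vanishes_on p Z -> gradient p x *m v = 0.

(* Jacobian criterion: in the Zariski open neighbourhood [h <> 0] of [x], the
   set [Z] is cut out by [c] equations (its local codimension) whose
   differentials at [x] are linearly independent. *)
Definition smooth_pt Z x : Prop :=
  Z x /\
  exists (c : nat) (g : 'I_c -> {mpoly K[n]}) (h : {mpoly K[n]}),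
  [/\ peval h x != 0,
      forall y, peval h y != 0 -> (Z y <-> forall k, peval (g k) y = 0)
    & row_free (\matrix_k gradient (g k) x)].

(* Points of P^(n-1) are represented by their nonzero affine
   representatives. *)
Definition smooth_hypersurface p : Prop :=
  forall x, x != 0 -> peval p x = 0 -> gradient p x != 0.

Definition affine_cone p : 'cV[K]_n -> Prop := fun x => peval p x = 0.

Definition bilinear_form (M : 'M[K]_n) (v w : 'cV[K]_n) : K :=
  (v^T *m M *m w) 0 0.

Definition quadratic_form (M : 'M[K]_n) : {mpoly K[n]} :=
  \sum_i \sum_j M i j *: ('X_i * 'X_j).

End AffineGeometry.

Section EDdegree.
Variables (K : fieldType) (n : nat).
Variables (Z : 'cV[K]_n -> Prop) (Q : 'cV[K]_n -> 'cV[K]_n -> K).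

Definition normal (x w : 'cV[K]_n) : Prop :=
  forall v, tangent Z x v -> Q w v = 0.

(* V x V is identified with the affine space of stacked vectors
   [col_mx x u]. *)
Definition ED_correspondence : 'cV[K]_(n + n) -> Prop :=
  zclosure (fun z => smooth_pt Z (usubmx z)
                     /\ normal (usubmx z) (dsubmx z - usubmx z)).

Definition ED_fiber (u : 'cV[K]_n) : 'cV[K]_n -> Prop :=
  fun x => ED_correspondence (col_mx x u).

Definition ED_dominant : Prop :=
  forall u, zclosure (fun u' => exists x, ED_fiber u' x) u.

(* Over an infinite field this holds for at most one [d], since two nonempty
   Zariski open sets meet. *)
Definition EDdegree_is (d : nat) : Prop :=
  (ED_dominant /\ generically (fun u => has_card (ED_fiber u) d))
  \/ (~ ED_dominant /\ d = 0%N).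

End EDdegree.

(* The complexification of a real matrix. *)
Definition complexify (R : realType) (m n : nat) (M : 'M[R]_(m, n)) :
  'M[R[i]]_(m, n) := map_mx (real_complex R) M.

Definition positive_definite (R : realType) (n : nat) (M : 'M[R]_n) : Prop :=
  forall x : 'cV[R]_n, x != 0 -> 0 < bilinear_form M x x.

(* Main.v *)
Require Import Defs.
From mathcomp Require Import all_boot all_order all_algebra separable.
From mathcomp Require Import complex mpoly.
From mathcomp Require Import reals.
From mathcomp Require Import ring.

(**
Write A and Q for the two symmetric matrices and B = Q^-1 A. Away from the
vertex the normal space of the cone x^T A x = 0 at x is the line spanned by
B x, so the critical points for the data u are the solutions x <> 0 of

     x^T A x = 0,    u = x + l B x    for some scalar l.

Since Q is real and positive definite and B is Q-self-adjoint, B has real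
eigenvalues a_j and is diagonalisable, with spectral projectors P_j that are
polynomials in B and hence Q-self-adjoint as well. Projecting the second
equation gives P_j x = (1 + l a_j)^-1 P_j u, and with q_j (u) = Q (P_j u, P_j u)
the first one becomes

     sum_j a_j q_j (u) / (1 + l a_j)^2 = 0.

Clearing denominators yields the secular polynomial in l,

     sum_j (q_j (u) / a_j) prod_(k <> j) (l - b_k)^2,     b_k = - 1 / a_k,

of degree 2 (r - 1) when its leading coefficient sum_j q_j (u) / a_j does not
vanish. For generic u its roots are simple and avoid the b_k, and they
parametrise the critical points bijectively (ED_fiber_card).

Three points need an argument.

- The correspondence is a Zariski closure, so extra points could appear over a
  generic u. The condition u - x in the span of B x is closed except at x = 0,
  where it is void (ED_fiber_equations). The points (0, u) are excluded by the
  dual quadric: with u - x = l B x, the vector u - x satisfies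
  sum_j q_j (u - x) / a_j = l^2 x^T A x = 0, and this survives in the closure;
  at x = 0 it is the vanishing of the leading coefficient above.

- The tangent space is defined through all polynomials that vanish on the cone.
  That it is no smaller than expected is seen from parametrised curves lying on
  the cone (tangent_quadric).

- Simple roots for generic u: the discriminant is a polynomial in u, so one good
  u suffices. The weights q_j (u) / a_j can be prescribed freely, and in the
  pencil c f + g of coprime polynomials only finitely many c give a multiple
  root, because at such a root the Wronskian of f and g vanishes
  (exists_coprime_secular).

If r = 1, then A is a multiple of Q and all critical points have isotropic data
u, so the correspondence does not dominate the data space and the degree is 0.
*)

Set Implicit Arguments.
Unset Strict Implicit.
Unset Printing Implicit Defensive.

Import Order.TTheory GRing.Theory Num.Theory.
Local Open Scope ring_scope.

(** * Polynomial functions on affine space *)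

Lemma mpoly_alg_ind (R : comNzRingType) (n : nat) (P : {mpoly R[n]} -> Prop) :
    (forall c, P c%:MP) -> (forall i, P 'X_i) ->
    (forall p q, P p -> P q -> P (p + q)) ->
    (forall p q, P p -> P q -> P (p * q)) ->
  forall p, P p.
Proof.
move=> PC PX PD PM; elim/mpolyind=> [|c m p _ _ Pp]; first by rewrite -mpolyC0.
apply: (PD) => //; rewrite -mul_mpolyC; apply: (PM) => //.
rewrite mpolyXE_id; apply: (big_ind P); first by rewrite -mpolyC1.
  by move=> *; apply: (PM).
move=> i _; elim: (m i) => [|k IH]; first by rewrite expr0 -mpolyC1.
by rewrite exprS; apply: PM.
Qed.

Section PolynomialsOnAffineSpace.
Variable K : numFieldType.

Lemma poly_vanish0 (q : {poly K}) : (forall t, q.[t] = 0) -> q = 0.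
Proof.
move=> q0; apply/eqP; apply: contraT => nz_q.
have := @max_poly_roots K q [seq i%:R | i <- iota 0 (size q)] nz_q.
rewrite size_map size_iota ltnn; apply.
  by apply/allP => t _; rewrite rootE q0.
rewrite map_inj_uniq ?iota_uniq // => i j /eqP.
by rewrite eqr_nat => /eqP.
Qed.

Variable n : nat.
Implicit Types (p : {mpoly K[n]}) (x v w : 'cV[K]_n).

(** Restriction of a polynomial to a curve with polynomial coordinates. *)
Definition along (g : 'I_n -> {poly K}) p : {poly K} := mmap polyC g p.

Lemma horner_along g p t :
  (along g p).[t] = peval p (\col_i (g i).[t]).
Proof.
rewrite /along /peval; elim/mpoly_alg_ind: p => [c|i|p q IHp IHq|p q IHp IHq].
- by rewrite mmapC mevalC hornerC.
- by rewrite mmapX mmap1U mevalXU mxE.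
- by rewrite mmapD mevalD hornerD IHp IHq.
- by rewrite rmorphM mevalM hornerM IHp IHq.
Qed.

(** The chain rule: both sides are derivations in [p] that agree on variables. *)
Lemma deriv_along g p :
  (along g p)^`() = \sum_i along g p^`M(i) * (g i)^`().
Proof.
rewrite /along; elim/mpoly_alg_ind: p => [c|i|p q IHp IHq|p q IHp IHq].
- by rewrite mmapC derivC big1 // => i _; rewrite mderivC mmap0 mul0r.
- rewrite mmapX mmap1U (bigD1 i) //= big1 => [|j ji].
    rewrite mderivX mnm1E eqxx -{1}[U_(i)%MM]add0m addmK scale1r mpolyX0.
    by rewrite rmorph1 mul1r addr0.
  by rewrite mderivX mnm1E eq_sym (negPf ji) scale0r mmap0 mul0r.
- rewrite mmapD derivD IHp IHq -big_split; apply: eq_bigr => i _ /=.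
  by rewrite mderivD mmapD mulrDl.
- rewrite rmorphM /= derivM IHp IHq mulr_suml mulr_sumr -big_split.
  apply: eq_bigr => i _ /=.
  by rewrite mderivM mmapD !rmorphM /=; ring.
Qed.

(** The way tangent vectors are produced: if [p] vanishes along a parametrised
    curve, then its differential kills the velocity. Arcs of degree two are
    all that quadrics require. *)
Lemma gradient_along p x v w :
    (forall t, peval p (x + t *: v + t ^+ 2 *: w) = 0) ->
  gradient p x *m v = 0.
Proof.
move=> p0; pose g i := (x i 0)%:P + v i 0 *: 'X + w i 0 *: 'X^2.
have gE t : \col_i (g i).[t] = x + t *: v + t ^+ 2 *: w.
  by apply/colP=> i; rewrite !mxE !hornerE /=; ring.
have /(congr1 (fun q => q^`().[0])) : along g p = 0.
  by apply: poly_vanish0 => t; rewrite horner_along gE.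
rewrite derivC horner0 deriv_along horner_sum => D0.
apply/matrixP=> i j; rewrite !ord1 mxE [RHS]mxE -[RHS]D0.
apply: eq_bigr => k _; rewrite hornerM horner_along gE mxE.
rewrite scale0r expr0n scale0r !addr0; congr (_ * _).
by rewrite !derivE !hornerE /=; ring.
Qed.

Lemma peval_gradient0 p : (forall x, peval p x = 0) ->
  forall i x, peval p^`M(i) x = 0.
Proof.
move=> p0 i x; have := @gradient_along p x (delta_mx i 0) 0 (fun t => p0 _).
by rewrite -colE => /colP/(_ 0); rewrite !mxE.
Qed.

(** All iterated derivatives of such a [p] vanish identically too, and their
    values at the origin are the coefficients of [p] up to factorials, which
    are invertible in characteristic zero. *)
Lemma peval_inj0 p : (forall x, peval p x = 0) -> p = 0.
Proof.
move=> p0; apply/mpolyP=> m; rewrite mcoeff0.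
have {p0} : forall x, peval p^`M[m] x = 0.
  rewrite mderivm_foldr; elim: (flatten _) => //= i s IH.
  exact: peval_gradient0.
have peval0 (q : {mpoly K[n]}) : peval q 0 = q@_0.
  rewrite /peval; elim/mpoly_alg_ind: q => [c|i|q1 q2 IH1 IH2|q1 q2 IH1 IH2].
  - by rewrite mevalC mcoeffC eqxx mulr1.
  - by rewrite mevalXU mcoeffX mnm1_eq0 mxE.
  - by rewrite mevalD mcoeffD IH1 IH2.
  - by rewrite mevalM rmorphM /= IH1 IH2.
move/(_ 0)/eqP; rewrite peval0 mcoeff_mderivm addm0 mulrn_eq0.
by rewrite eqn0Ngt prodn_gt0 => [/eqP //|i]; rewrite ffact_gt0.
Qed.

End PolynomialsOnAffineSpace.

(** * Tangent and normal spaces of a quadric cone *)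

Section BilinearForms.
Variables (K : fieldType) (n : nat).
Implicit Types (M B T : 'M[K]_n) (x y z : 'cV[K]_n).

Lemma bilinearDl M x y z :
  bilinear_form M (x + y) z = bilinear_form M x z + bilinear_form M y z.
Proof. by rewrite /bilinear_form linearD !mulmxDl mxE. Qed.

Lemma bilinearDr M x y z :
  bilinear_form M x (y + z) = bilinear_form M x y + bilinear_form M x z.
Proof. by rewrite /bilinear_form mulmxDr mxE. Qed.

Lemma bilinearZl M c x y :
  bilinear_form M (c *: x) y = c * bilinear_form M x y.
Proof. by rewrite /bilinear_form linearZ -!scalemxAl mxE. Qed.

Lemma bilinearZr M c x y :
  bilinear_form M x (c *: y) = c * bilinear_form M x y.
Proof. by rewrite /bilinear_form -scalemxAr mxE. Qed.

Definition bilinearE := (bilinearDl, bilinearDr, bilinearZl, bilinearZr).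

Lemma bilinear0l M x : bilinear_form M 0 x = 0.
Proof. by rewrite -(scale0r 0) bilinearZl mul0r. Qed.

Lemma bilinear0r M x : bilinear_form M x 0 = 0.
Proof. by rewrite -(scale0r 0) bilinearZr mul0r. Qed.

Lemma bilinear_tr M x y : bilinear_form M^T x y = bilinear_form M y x.
Proof.
have -> : bilinear_form M y x = (y^T *m M *m x)^T 0 0 by rewrite mxE.
by rewrite !trmx_mul trmxK mulmxA.
Qed.

Lemma bilinearMr M B x y :
  bilinear_form (M *m B) x y = bilinear_form M x (B *m y).
Proof. by rewrite /bilinear_form !mulmxA. Qed.

Lemma bilinear_self_adjoint M T x y : T^T *m M = M *m T ->
  bilinear_form M (T *m x) y = bilinear_form M x (T *m y).
Proof.
move=> MT; rewrite /bilinear_form trmx_mul -!mulmxA.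
by rewrite [_^T *m (M *m _)]mulmxA MT !mulmxA.
Qed.

Lemma bilinear_sumr M (I : finType) (F : I -> 'cV[K]_n) y :
  bilinear_form M y (\sum_i F i) = \sum_i bilinear_form M y (F i).
Proof. by rewrite /bilinear_form mulmx_sumr summxE. Qed.

Lemma bilinear_formB M B x y :
  bilinear_form (M - B) x y = bilinear_form M x y - bilinear_form B x y.
Proof. by rewrite /bilinear_form mulmxBr mulmxBl !mxE. Qed.

Lemma bilinear_form_sum (I : finType) (c : I -> K) (M : I -> 'M[K]_n) x y :
  bilinear_form (\sum_i c i *: M i) x y = \sum_i c i * bilinear_form (M i) x y.
Proof.
rewrite /bilinear_form mulmx_sumr mulmx_suml summxE.
by apply: eq_bigr => i _; rewrite -scalemxAr -scalemxAl mxE.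
Qed.

Lemma bilinear_delta i j x y :
  bilinear_form (delta_mx i j) x y = x i 0 * y j 0.
Proof.
rewrite /bilinear_form -(mul_delta_mx (0 : 'I_1)) mulmxA -colE -mulmxA -rowE.
by rewrite mxE big_ord1 !mxE.
Qed.

Lemma peval_quadratic M x : peval (quadratic_form M) x = bilinear_form M x x.
Proof.
rewrite /peval /quadratic_form raddf_sum /bilinear_form -mulmxA mxE.
apply: eq_bigr => i _; rewrite raddf_sum !mxE mulr_sumr.
by apply: eq_bigr => j _; rewrite /= mevalZ mevalM !mevalXU; ring.
Qed.

Lemma gradient_quadratic M x :
  gradient (quadratic_form M) x = x^T *m (M + M^T).
Proof.
have dX (i j : 'I_n) : ('X_i : {mpoly K[n]})^`M(j) = (i == j)%:R%:MP.
  rewrite mderivX mnm1E; case: eqP => [->|_]; last first.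
    by rewrite scale0r mpolyC0.
  by rewrite -{1}[U_(j)%MM]add0m addmK scale1r mpolyX0 mpolyC1.
apply/rowP=> k; rewrite !mxE /quadratic_form (raddf_sum (mderiv k)).
rewrite /peval raddf_sum /=.
transitivity (\sum_i (\sum_j x i 0 * M i j * (j == k)%:R
                      + (\sum_j x j 0 * M i j) * (i == k)%:R)).
  apply: eq_bigr => i _.
  rewrite (raddf_sum (mderiv k)) raddf_sum mulr_suml -big_split /=.
  apply: eq_bigr => j _.
  by rewrite mderivZ mevalZ mderivM !dX mevalD !mevalM !mevalC !mevalXU; ring.
rewrite big_split /= [X in _ + X](bigD1 k) //= eqxx mulr1.
rewrite [X in _ + (_ + X)]big1 => [|i /negPf->]; last by rewrite mulr0.
rewrite addr0 -big_split; apply: eq_bigr => i _ /=; rewrite !mxE mulrDr.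
rewrite (bigD1 k) //= eqxx mulr1 big1 => [|j /negPf->]; last by rewrite mulr0.
by rewrite addr0.
Qed.

End BilinearForms.

Lemma bilinear_congr (K : fieldType) (m n : nat) (M : 'M[K]_n)
    (S T : 'M[K]_(n, m)) (z t : 'cV[K]_m) :
  bilinear_form (S^T *m M *m T) z t = bilinear_form M (S *m z) (T *m t).
Proof. by rewrite /bilinear_form trmx_mul !mulmxA. Qed.

Section QuadricTangent.
Variables (K : numClosedFieldType) (n : nat) (A : 'M[K]_n).
Hypotheses (n_gt1 : (1 < n)%N) (symA : A^T = A) (unitA : A \in unitmx).
Implicit Types (x v w : 'cV[K]_n).

Let Z := affine_cone (quadratic_form A).

Let bilA x y : bilinear_form A x y = bilinear_form A y x.
Proof. by rewrite -bilinear_tr symA. Qed.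

Lemma gradient_sym_quadratic x :
  gradient (quadratic_form A) x = 2 *: (x^T *m A).
Proof. by rewrite gradient_quadratic symA mulmxDr scaler_nat mulr2n. Qed.

(** On the line through two basis vectors the form is a quadratic polynomial in
    the parameter, so it has a root. *)
Lemma exists_isotropic : exists2 x, x != 0 & bilinear_form A x x = 0.
Proof.
pose i0 := Ordinal (ltnW n_gt1); pose i1 := Ordinal n_gt1.
pose e0 : 'cV[K]_n := delta_mx i0 0; pose e1 : 'cV[K]_n := delta_mx i1 0.
have [e1iso|e1an] := eqVneq (bilinear_form A e1 e1) 0.
  exists e1 => //; apply/eqP => /colP/(_ i1)/eqP.
  by rewrite !mxE !eqxx oner_eq0.
pose a := bilinear_form A e1 e1; pose b := bilinear_form A e0 e1.
pose c := bilinear_form A e0 e0.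
pose s := sqrtC (b ^+ 2 - a * c).
exists (e0 + (s - b) / a *: e1).
  by apply/eqP => /colP/(_ i0)/eqP; rewrite !mxE /= mulr0 addr0 oner_eq0.
rewrite !bilinearE (bilA e1 e0) -/a -/b -/c.
have s2 : s ^+ 2 = b ^+ 2 - a * c by rewrite sqrtCK.
transitivity ((s ^+ 2 - (b ^+ 2 - a * c)) / a); first by field.
by rewrite s2 subrr mul0r.
Qed.

Lemma exists_paired x : x != 0 -> exists w, bilinear_form A x w = 1.
Proof.
move=> x0; have : x^T *m A != 0.
  apply: contra x0 => /eqP/(congr1 (fun y => y *m invmx A)).
  by rewrite mulmxK // mul0mx => /(congr1 trmx); rewrite trmxK linear0 => ->.
case/rV0Pn => i di; pose d := (x^T *m A) 0 i.
exists (d^-1 *: delta_mx i 0).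
by rewrite bilinearZr /bilinear_form -colE mxE mulVf.
Qed.

Lemma exists_isotropic_paired x : x != 0 -> bilinear_form A x x = 0 ->
  exists2 w, bilinear_form A x w = 1 & bilinear_form A w w = 0.
Proof.
move=> x0 xiso; have [w xw] := exists_paired x0.
exists (w - bilinear_form A w w / 2 *: x).
  by rewrite -scaleNr !bilinearE xiso xw mulr0 addr0.
rewrite -scaleNr !bilinearE xiso (bilA w x) xw.
by field.
Qed.

(** A linear functional that vanishes on all isotropic vectors is zero: fix an
    isotropic [x]; every [v] with [A(x, v) <> 0] becomes isotropic after adding
    a multiple of [x], and the vectors [v] with [A(x, v) = 0] are differences of
    such vectors. *)
Lemma tangent_vertex v : tangent Z 0 v.
Proof.
move=> p pZ; set c := gradient p 0.
have iso_c w : bilinear_form A w w = 0 -> c *m w = 0.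
  move=> wiso; apply: (@gradient_along _ _ p 0 w 0) => t; apply: pZ.
  rewrite /Z /affine_cone peval_quadratic scaler0 add0r addr0 !bilinearE wiso.
  by rewrite !mulr0.
have [x x0 xiso] := exists_isotropic.
have paired_c w : bilinear_form A x w != 0 -> c *m w = 0.
  move=> xw; pose k := - bilinear_form A w w / (2 * bilinear_form A x w).
  have /iso_c : bilinear_form A (w + k *: x) (w + k *: x) = 0.
    by rewrite !bilinearE xiso (bilA w x) /k; field.
  by rewrite mulmxDr -scalemxAr (iso_c x xiso) scaler0 addr0.
have [xv|] := eqVneq (bilinear_form A x v) 0; last exact: paired_c.
have [w xw] := exists_paired x0.
rewrite -[v](addrK w) mulmxBr !paired_c ?subr0 //.
  by rewrite xw oner_eq0.
by rewrite bilinearDr xv xw add0r oner_eq0.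
Qed.

(** Let [w] be isotropic with [A(x, w) = 1] and put [b = A(v, w)]. The points
    [(1 + b t) (x + t v) - (t^2 A(v, v) / 2) w] lie on the cone, by the choice
    of the coefficient of [w]; their velocity at [t = 0] is [v + b x], and the
    radial direction [x] is tangent as well. *)
Lemma tangent_quadric x v :
  Z x -> bilinear_form A x v = 0 -> tangent Z x v.
Proof.
rewrite /Z /affine_cone peval_quadratic => xiso xv.
have [->|x0] := eqVneq x 0; first exact: tangent_vertex.
have [w xw wiso] := exists_isotropic_paired x0 xiso.
move=> p pZ; pose b := bilinear_form A v w; pose f := bilinear_form A v v.
have gx : gradient p x *m x = 0.
  apply: (@gradient_along _ _ p x x 0) => t; apply: pZ.
  rewrite /affine_cone peval_quadratic scaler0 addr0 !bilinearE xiso.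
  by rewrite !mulr0 !addr0.
have : gradient p x *m (v + b *: x) = 0.
  apply: (@gradient_along _ _ p x _ (b *: v - f / 2 *: w)) => t; apply: pZ.
  have -> : x + t *: (v + b *: x) + t ^+ 2 *: (b *: v - f / 2 *: w)
          = (1 + b * t) *: (x + t *: v) + - (t ^+ 2 * (f / 2)) *: w.
    by apply/colP => i; rewrite !mxE; ring.
  rewrite /affine_cone peval_quadratic !bilinearE (bilA w x) (bilA w v).
  by rewrite (bilA v x) xiso xv xw wiso -/b -/f; field.
by rewrite mulmxDr -scalemxAr gx scaler0 addr0.
Qed.

(** The quadratic form itself is a local equation, and its differential at [x]
    is nonzero because the form is nondegenerate. *)
Lemma smooth_pt_quadric x : x != 0 -> Z x -> smooth_pt Z x.
Proof.
move=> x0 Zx; split=> //; exists 1, (fun=> quadratic_form A), 1.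
split=> [|y _|]; first by rewrite /peval meval1 oner_eq0.
  by split=> [Zy _ //|/(_ 0)].
rewrite /row_free (_ : \matrix_k _ = gradient (quadratic_form A) x).
  rewrite rank_rV gradient_sym_quadratic scaler_eq0 pnatr_eq0 /=.
  have [w xw] := exists_paired x0.
  suff -> : x^T *m A != 0 by [].
  apply/eqP => xA; move: xw; rewrite /bilinear_form xA mul0mx mxE => /eqP.
  by rewrite eq_sym oner_eq0.
by apply/rowP => i; rewrite mxE.
Qed.

Lemma tangent_quadric_orthogonal x v :
  tangent Z x v -> bilinear_form A x v = 0.
Proof.
move/(_ (quadratic_form A) (fun y Zy => Zy)).
rewrite gradient_sym_quadratic -scalemxAl => /eqP.
rewrite scaler_eq0 pnatr_eq0 /= => /eqP/matrixP/(_ 0 0).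
by rewrite [RHS]mxE.
Qed.

Variable Q : 'M[K]_n.
Hypotheses (symQ : Q^T = Q) (unitQ : Q \in unitmx).

(** The functionals [Q(w, .)] that vanish on the kernel of [A(x, .)] are its
    multiples. At [x = 0] this says that only [w = 0] is normal. *)
Lemma normal_quadricP x w : Z x ->
  (normal Z (bilinear_form Q) x w <-> exists l, w = l *: (invmx Q *m A *m x)).
Proof.
move=> Zx; split=> [nw|[l ->] v tv].
  have : (w^T *m Q <= x^T *m A)%MS.
    rewrite submxE; apply/eqP/rowP => j; rewrite [RHS]mxE.
    pose v : 'cV_n := cokermx (x^T *m A) *m delta_mx j 0.
    have xv : bilinear_form A x v = 0.
      by rewrite /bilinear_form /v mulmxA mulmx_coker mul0mx mxE.
    have := nw v (tangent_quadric Zx xv).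
    by rewrite /bilinear_form /v mulmxA -colE mxE.
  case/sub_rVP => l /(congr1 trmx).
  rewrite linearZ /= !trmx_mul !trmxK symQ symA => wl; exists l.
  by rewrite -mulmxA scalemxAr -wl mulKmx.
rewrite bilinearZl -(bilinear_tr Q v) symQ. 
rewrite -bilinearMr mulmxA mulmxV // mul1mx bilA.
by rewrite tangent_quadric_orthogonal ?mulr0.
Qed.

End QuadricTangent.

(** * Secular polynomials *)

Lemma exists_notin (K : numDomainType) (s : seq K) : exists c, c \notin s.
Proof.
pose l : seq K := [seq i%:R | i <- iota 0 (size s).+1].
have ul : uniq l.
  rewrite map_inj_uniq ?iota_uniq // => i j /eqP.
  by rewrite eqr_nat => /eqP.
have [/allP ls|] := boolP (all (mem s) l).
  by have := uniq_leq_size ul ls; rewrite size_map size_iota ltnn.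
by case/allPn => c _ cs; exists c.
Qed.

Lemma size_deriv_num (K : numDomainType) (p : {poly K}) :
  size p^`() = (size p).-1.
Proof.
case sp: (size p) => [|[|d]] /=.
- by move/eqP: sp; rewrite size_poly_eq0 => /eqP ->; rewrite derivC size_poly0.
- by rewrite (size1_polyC (eq_leq sp)) derivC size_poly0.
have p0 : p != 0 by rewrite -size_poly_eq0 sp.
apply/eqP; rewrite eqn_leq -ltnS -sp lt_size_deriv //= ltnNge.
apply: contra p0 => /leq_sizeP/(_ _ (leqnn _))/eqP.
by rewrite coef_deriv mulrn_eq0 /= -lead_coef_eq0 lead_coefE sp.
Qed.

(** Preservation of both degrees is essential: the size of the Sylvester matrix
    depends on them. *)
Lemma resultant_map (R S : comNzRingType) (f : {rmorphism R -> S})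
    (p q : {poly R}) :
    size (map_poly f p) = size p -> size (map_poly f q) = size q ->
  f (resultant p q) = resultant (map_poly f p) (map_poly f q).
Proof.
move=> fp fq; rewrite /resultant /Sylvester_mx fp fq -det_map_mx map_col_mx.
by congr (\det (col_mx _ _)); apply: map_lin1_mx => v;
  rewrite map_poly_rV rmorphM /= map_rVpoly.
Qed.

Lemma simple_roots (K : numClosedFieldType) (p : {poly K}) :
    p != 0 -> coprimep p p^`() ->
  exists s : seq K,
    [/\ uniq s, size s = (size p).-1 & forall z, (z \in s) = root p z].
Proof.
move=> p0 cop; have [s defp] := closed_field_poly_normal p.
have l0 : lead_coef p != 0 by rewrite lead_coef_eq0.
exists s; split=> [||z].
- move: cop; rewrite defp derivZ coprimepZl // coprimepZr //.
  by rewrite -separable_prod_XsubC separable_poly.unlock.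
- by rewrite defp size_scale // size_prod_XsubC.
- by rewrite defp rootZ // root_prod_XsubC.
Qed.

Section SecularPolynomial.
Variables (K : numClosedFieldType) (I : finType) (b : I -> K).
Hypothesis b_inj : injective b.

Definition cofactor_sq j : {poly K} := \prod_(k | k != j) ('X - (b k)%:P) ^+ 2.

(** Numerator of the rational function [sum_j w j / (X - b j)^2]. *)
Definition secular (w : I -> K) : {poly K} := \sum_j w j *: cofactor_sq j.

Lemma cofactor_sq_monic j : cofactor_sq j \is monic.
Proof. by apply: monic_prod => k _; rewrite monic_exp ?monicXsubC. Qed.

Lemma size_cofactor_sq j : size (cofactor_sq j) = (2 * (#|I| - 1)).+1.
Proof.
rewrite -[LHS]prednK; last first.
  by rewrite lt0n size_poly_eq0 monic_neq0 ?cofactor_sq_monic.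
rewrite /cofactor_sq prodrXl size_exp -big_filter size_prod_XsubC /=.
by rewrite size_filter -sum1_count sum1_card cardC1 mulnC subn1.
Qed.

Lemma cofactor_sq_root j k : k != j -> (cofactor_sq j).[b k] = 0.
Proof.
move=> kj; rewrite /cofactor_sq (bigD1 k) //= hornerM horner_exp !hornerE.
by rewrite subrr expr0n mul0r.
Qed.

Lemma cofactor_sq_self j : (cofactor_sq j).[b j] != 0.
Proof.
rewrite horner_prod prodf_seq_neq0; apply/allP => k _ /=; apply/implyP => kj.
by rewrite horner_exp !hornerE expf_neq0 // subr_eq0 (inj_eq b_inj) eq_sym.
Qed.

Lemma root_cofactor_sq j z :
  root (cofactor_sq j) z -> exists2 k, k != j & z = b k.
Proof.
rewrite /root horner_prod => /prodf_eq0[k kj].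
rewrite horner_exp expf_eq0 /= !hornerE subr_eq0 => /eqP ->.
by exists k.
Qed.

Lemma horner_secular_pole w j : (secular w).[b j] = w j * (cofactor_sq j).[b j].
Proof.
rewrite /secular horner_sum (bigD1 j) //= hornerZ big1 ?addr0 // => k kj.
by rewrite hornerZ cofactor_sq_root ?mulr0 // eq_sym.
Qed.


Lemma size_secular_leq w : (size (secular w) <= (2 * (#|I| - 1)).+1)%N.
Proof.
apply: (leq_trans (size_sum _ _ _)); apply/bigmax_leqP => j _.
by apply: (leq_trans (size_scale_leq _ _)); rewrite size_cofactor_sq.
Qed.

Lemma coef_secular_top w : (secular w)`_(2 * (#|I| - 1)) = \sum_j w j.
Proof.
rewrite coef_sum; apply: eq_bigr => j _; rewrite coefZ.
have := cofactor_sq_monic j; rewrite monicE lead_coefE size_cofactor_sq /=.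
by move/eqP->; rewrite mulr1.
Qed.

Lemma size_secular w : \sum_j w j != 0 ->
  size (secular w) = (2 * (#|I| - 1)).+1.
Proof.
move=> w0; apply/eqP; rewrite eqn_leq size_secular_leq /= ltnNge.
by apply: contra w0 => /leq_sizeP/(_ _ (leqnn _)); rewrite coef_secular_top => ->.
Qed.

(** Give one weight the value [c] and the others the value 1, so that the secular
    polynomial is [c f + g]. A double root [z] is a zero of the Wronskian
    [f' g - f g'], a nonzero polynomial since [f] and [g] are coprime and [f]
    is not constant; and [f(z) <> 0] by coprimality, so that [c] is determined
    by [z]. Hence only finitely many values of [c] are bad. *)
Lemma exists_coprime_secular : (1 < #|I|)%N -> exists w,
  \sum_j w j != 0 /\ coprimep (secular w) (secular w)^`().
Proof.
move=> I_gt1; have /card_gt0P[i0 _] : (0 < #|I|)%N by apply: ltnW.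
pose f := cofactor_sq i0; pose g := secular (fun j => (j != i0)%:R).
have fg_coprime : coprimep f g.
  apply: Pdiv.ClosedField.root_coprimep => z /root_cofactor_sq[k ki0 ->].
  by rewrite horner_secular_pole ki0 mul1r cofactor_sq_self.
pose W := f^`() * g - f * g^`().
have W_neq0 : W != 0.
  apply/eqP => /eqP; rewrite subr_eq0 => /eqP W0.
  have : f %| f^`() by rewrite -(Gauss_dvdpl _ fg_coprime) W0 dvdp_mulr.
  have f0 : f != 0 by rewrite monic_neq0 ?cofactor_sq_monic.
  have df0 : f^`() != 0.
    rewrite -size_poly_eq0 size_deriv_num size_cofactor_sq /= muln_eq0 /=.
    by rewrite subn_eq0 -ltnNge.
  by move/(dvdp_leq df0); rewrite leqNgt lt_size_deriv.
have [rW defW] := closed_field_poly_normal W.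
have mem_rW z : root W z -> z \in rW.
  by rewrite defW rootZ ?lead_coef_eq0 // root_prod_XsubC.
(* The first excluded value is the one for which the weights sum to zero. *)
have [c] := exists_notin (- (\sum_j (j != i0)%:R)
                            :: [seq - (g.[z] / f.[z]) | z <- rW]).
rewrite inE negb_or => /andP[c_sum c_W].
exists (fun j => c * (j == i0)%:R + (j != i0)%:R); split.
  rewrite big_split -mulr_sumr /= [X in c * X](bigD1 i0) //= eqxx.
  rewrite [X in c * (_ + X)]big1 => [|j /negPf-> //].
  by rewrite addr0 mulr1 addr_eq0.
have -> : secular (fun j => c * (j == i0)%:R + (j != i0)%:R) = c *: f + g.
  rewrite /g /secular; under eq_bigr do rewrite scalerDl.
  rewrite big_split /=; congr (_ + _); rewrite (bigD1 i0) //= eqxx mulr1.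
  by rewrite big1 ?addr0 // => j /negPf->; rewrite mulr0 scale0r.
apply: Pdiv.ClosedField.root_coprimep => z.
rewrite rootE derivD derivZ !hornerE => cfg0.
apply/eqP => cdfg0; have fz : f.[z] != 0.
  apply/eqP => fz; have := coprimep_root fg_coprime (_ : root f z).
  rewrite rootE fz eqxx => /(_ isT).
  by move: cfg0; rewrite fz mulr0 add0r => ->.
have gE : g.[z] = - (c * f.[z]) by apply/eqP; rewrite -addr_eq0 addrC.
have dgE : g^`().[z] = - (c * f^`().[z]).
  by apply/eqP; rewrite -addr_eq0 addrC cdfg0.
case/negP: c_W; apply/mapP; exists z; last by rewrite gE; field.
by apply: mem_rW; rewrite rootE !hornerE gE dgE; apply/eqP; ring.
Qed.

Lemma horner_secular w l : (forall j, l != b j) ->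
  (secular w).[l] = (\prod_k (l - b k) ^+ 2) * \sum_j w j / (l - b j) ^+ 2.
Proof.
move=> lb; rewrite horner_sum mulr_sumr; apply: eq_bigr => j _.
rewrite hornerZ horner_prod [X in _ = X * _](bigD1 j) //=.
under eq_bigr do rewrite horner_exp !hornerE.
have : l - b j != 0 by rewrite subr_eq0.
by move: (\prod_(k | _) _) (l - b j) => c d d0; field.
Qed.

End SecularPolynomial.

(** * The ED correspondence of a diagonalised quadric *)

Section EDQuadric.
Variables (K : numClosedFieldType) (n : nat) (A Q : 'M[K]_n).
Hypotheses (n_gt1 : (1 < n)%N) (symA : A^T = A) (unitA : A \in unitmx).
Hypotheses (symQ : Q^T = Q) (unitQ : Q \in unitmx).
Variables (I : finType) (a : I -> K) (P : I -> 'M[K]_n) (e : I -> 'cV[K]_n).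
Hypotheses (a_inj : injective a) (a_neq0 : forall j, a j != 0).
(** A spectral resolution [P] of the pencil, with nonzero pairwise distinct
    eigenvalues [a] and a non-isotropic eigenvector [e j] in each eigenspace. *)
Hypothesis P_sum : \sum_j P j = 1%:M.
Hypothesis P_mul : forall j k, P j *m P k = (j == k)%:R *: P j.
Hypothesis P_adj : forall j, (P j)^T *m Q = Q *m P j.
Hypothesis P_spectral : invmx Q *m A = \sum_j a j *: P j.
Hypothesis P_e : forall j, P j *m e j = e j.
Hypothesis e_anisotropic : forall j, bilinear_form Q (e j) (e j) != 0.
Implicit Types (x u : 'cV[K]_n) (j k : I) (l : K).

Let Z := affine_cone (quadratic_form A).
Let B := invmx Q *m A.
Let b j := - (a j)^-1.
Let form x := bilinear_form A x x.

Let b_inj : injective b.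
Proof. by move=> j k /oppr_inj/invr_inj/a_inj. Qed.

(** The component of [Q(x, x)] carried by the [j]-th eigenspace; these numbers
    are the only invariants of the data that enter the secular equation. *)
Definition part j x := bilinear_form Q (P j *m x) (P j *m x).

Definition part_poly j : {mpoly K[n]} := quadratic_form ((P j)^T *m Q *m P j).

Lemma peval_part j x : peval (part_poly j) x = part j x.
Proof. by rewrite peval_quadratic bilinear_congr. Qed.

Lemma partZ j c x : part j (c *: x) = c ^+ 2 * part j x.
Proof. by rewrite /part -scalemxAr !bilinearE; ring. Qed.

Lemma P_pencil j x : P j *m (B *m x) = a j *: (P j *m x).
Proof.
rewrite /B P_spectral mulmxA mulmx_sumr mulmx_suml (bigD1 j) //= big1 => [|k kj].
  by rewrite addr0 -scalemxAr P_mul eqxx scale1r scalemxAl.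
by rewrite -scalemxAr P_mul eq_sym (negPf kj) scale0r scaler0 mul0mx.
Qed.

Lemma sum_P x : \sum_j P j *m x = x.
Proof. by rewrite -mulmx_suml P_sum mul1mx. Qed.

Lemma P_inj x y : (forall j, P j *m x = P j *m y) -> x = y.
Proof. by move=> xy; rewrite -[x]sum_P -[y]sum_P; apply: eq_bigr. Qed.

Lemma P_combination j (c : I -> K) (y : I -> 'cV[K]_n) :
  (forall k, P k *m y k = y k) -> P j *m (\sum_k c k *: y k) = c j *: y j.
Proof.
move=> Py; rewrite mulmx_sumr (bigD1 j) //= big1 => [|k kj].
  by rewrite addr0 -scalemxAr Py.
rewrite -Py -scalemxAr mulmxA P_mul eq_sym (negPf kj) scale0r mul0mx.
by rewrite scaler0.
Qed.

Lemma P_idem j x : P j *m (P j *m x) = P j *m x.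
Proof. by rewrite mulmxA P_mul eqxx scale1r. Qed.

Lemma form_parts x : form x = \sum_j a j * part j x.
Proof.
have -> : form x = bilinear_form Q x (B *m x).
  by rewrite -bilinearMr /B mulmxA mulmxV // mul1mx.
rewrite /B P_spectral mulmx_suml bilinear_sumr; apply: eq_bigr => j _.
rewrite -scalemxAl bilinearZr /part.
by rewrite (bilinear_self_adjoint _ _ (P_adj j)) P_idem.
Qed.

Lemma part_spectral_line j l x :
  part j (x + l *: (B *m x)) = (1 + l * a j) ^+ 2 * part j x.
Proof.
rewrite /part mulmxDr -scalemxAr P_pencil scalerA -{1 3}[P j *m x]scale1r.
by rewrite -scalerDl !bilinearE; ring.
Qed.

Let dual u := \sum_j part j u / a j.

(** Each of the three conditions is polynomial in [(x, u)] and holds on the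
    incidence set whose closure is the correspondence. The second one is the
    equation of the dual quadric in [u - x]; the third says that [u - x] and
    [B x] are parallel. *)
Lemma ED_fiber_equations u x : ED_fiber Z (bilinear_form Q) u x ->
  [/\ form x = 0, dual (u - x) = 0
    & forall i i', (u - x) i 0 * (B *m x) i' 0 = (u - x) i' 0 * (B *m x) i 0].
Proof.
(* [U] and [D] read off [x] and [u - x] from the stacked vector. *)
move=> Exu; pose U : 'M[K]_(n, n + n) := row_mx 1%:M 0.
pose D : 'M[K]_(n, n + n) := row_mx (- 1%:M) 1%:M.
have UE z : U *m z = usubmx z.
  by rewrite -{1}[z]vsubmxK mul_row_col mul1mx mul0mx addr0.
have DE z : D *m z = dsubmx z - usubmx z.
  by rewrite -{1}[z]vsubmxK mul_row_col mulNmx !mul1mx addrC.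
have closed (M : 'M[K]_n) (S T : 'M[K]_(n, n + n)) :
    (forall z l, form (U *m z) = 0 -> D *m z = l *: (B *m (U *m z)) ->
       bilinear_form M (S *m z) (T *m z) = 0) ->
  bilinear_form M (S *m col_mx x u) (T *m col_mx x u) = 0.
  move=> SMT; rewrite -bilinear_congr -peval_quadratic; apply: Exu => z.
  case=> [[Zz _] nz]; move: (Zz); rewrite /Z /affine_cone peval_quadratic => Fz.
  have [l dz] := (normal_quadricP n_gt1 symA unitA symQ unitQ _ Zz).1 nz.
  rewrite peval_quadratic bilinear_congr.
  by apply: (SMT z l); rewrite ?UE ?DE.
have Ux : U *m col_mx x u = x by rewrite UE col_mxKu.
have Dx : D *m col_mx x u = u - x by rewrite DE col_mxKu col_mxKd.
split.
- by have := closed A U U (fun _ _ Fz _ => Fz); rewrite Ux.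
- pose G := \sum_j (a j)^-1 *: ((P j)^T *m Q *m P j).
  have GE y : bilinear_form G y y = dual y.
    rewrite bilinear_form_sum; apply: eq_bigr => j _.
    by rewrite bilinear_congr mulrC.
  (* The dual form takes the value [l^2 form x] at [l *: (B *m x)]. *)
  have := closed G D D; rewrite Dx GE; apply => z l Fz ->.
  rewrite GE /dual; transitivity (l ^+ 2 * form (U *m z)).
    rewrite form_parts mulr_sumr; apply: eq_bigr => j _.
    by rewrite partZ /part P_pencil !bilinearE; field.
  by rewrite Fz mulr0.
- move=> i i'; apply/eqP; rewrite -subr_eq0; apply/eqP.
  pose E : 'M[K]_n := delta_mx i i' - delta_mx i' i.
  have EE y z : bilinear_form E y z = y i 0 * z i' 0 - y i' 0 * z i 0.
    by rewrite bilinear_formB !bilinear_delta.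
  have := closed E D (B *m U).
  rewrite Dx -[_ *m col_mx x u]mulmxA Ux EE; apply=> z l _ ->.
  by rewrite EE -[B *m U *m z]mulmxA !mxE; ring.
Qed.

Lemma critical_in_ED_fiber u x l :
    x != 0 -> form x = 0 -> u = x + l *: (B *m x) ->
  ED_fiber Z (bilinear_form Q) u x.
Proof.
move=> x0 Fx ux p; apply; rewrite col_mxKu col_mxKd.
have Zx : Z x by rewrite /Z /affine_cone peval_quadratic.
split; first exact: smooth_pt_quadric.
by apply/normal_quadricP => //; exists l; rewrite ux addrC addKr.
Qed.

(** The Lagrange multipliers of the critical points: away from the poles [b j],
    its roots are the [l] for which [critical_pt u l] lies on the cone. *)
Definition critical_poly u : {poly K} := secular b (fun j => part j u / a j).

Definition critical_pt u l : 'cV[K]_n := \sum_j (1 + l * a j)^-1 *: (P j *m u).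

Lemma P_critical_pt u l j :
  P j *m critical_pt u l = (1 + l * a j)^-1 *: (P j *m u).
Proof. by rewrite P_combination // => k; exact: P_idem. Qed.

Lemma horner_critical_poly u l : (forall j, l != b j) ->
  (critical_poly u).[l] = (\prod_k (l - b k) ^+ 2) * form (critical_pt u l).
Proof.
move=> lb; rewrite horner_secular // form_parts; congr (_ * _).
apply: eq_bigr => j _; rewrite /part P_critical_pt !bilinearE -/(part j u).
have la : 1 + l * a j = a j * (l - b j) by rewrite /b; field.
have lj : l - b j != 0 by rewrite subr_eq0.
by rewrite la; field; rewrite lj a_neq0.
Qed.

Definition generic_pt u := (forall j, part j u != 0) /\ dual u != 0.

(** Genericity is used twice: a nonzero [dual u] excludes [x = 0], and nonzero
    [part j u] keep [l] away from the poles [b j], where [1 + l a_j] vanishes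
    and [x] could not be recovered from [u]. *)
Lemma ED_fiberP u x : (0 < #|I|)%N -> generic_pt u ->
  ED_fiber Z (bilinear_form Q) u x <->
  exists2 l, root (critical_poly u) l & x = critical_pt u l.
Proof.
move=> I_gt0 [part0 dual0]; split=> [/ED_fiber_equations[Fx dual_ux minors]|[l]].
  have x0 : x != 0.
    by apply: contraNneq dual0 => x0; rewrite -dual_ux x0 subr0.
  have Bx0 : B *m x != 0.
    apply: contra x0 => /eqP Bx; rewrite -[x](mulKmx (_ : B \in unitmx)).
      by rewrite Bx mulmx0.
    by rewrite unitmx_mul unitmx_inv unitQ.
  have /cV0Pn[i' Bxi'] := Bx0.
  pose l := (u - x) i' 0 / (B *m x) i' 0.
  have ux : u = x + l *: (B *m x).
    apply/eqP; rewrite addrC -subr_eq; apply/eqP/colP => i; rewrite [RHS]mxE /l.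
    by rewrite mulrAC -minors mulfK.
  have Pu j' : P j' *m u = (1 + l * a j') *: (P j' *m x).
    by rewrite ux mulmxDr -scalemxAr P_pencil scalerA scalerDl scale1r.
  have la j' : 1 + l * a j' != 0.
    apply: contraNneq (part0 j') => la0.
    by rewrite /part Pu la0 scale0r bilinear0l.
  have xE : x = critical_pt u l.
    by apply: P_inj => k; rewrite P_critical_pt Pu scalerA mulVf ?scale1r.
  exists l => //; rewrite rootE horner_critical_poly -?xE ?Fx ?mulr0 // => k.
  apply: contra (la k) => /eqP ->; rewrite /b mulNr mulVf ?subrr //.
move=> rl ->.
have lb j : l != b j.
  apply: contraTneq rl => ->; rewrite rootE horner_secular_pole.
  by rewrite !mulf_neq0 ?invr_eq0 ?cofactor_sq_self.
have la j : 1 + l * a j != 0.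
  have -> : 1 + l * a j = a j * (l - b j) by rewrite /b; field.
  by rewrite mulf_neq0 ?subr_eq0.
have Pu j : P j *m u = (1 + l * a j) *: (P j *m critical_pt u l).
  by rewrite P_critical_pt scalerA mulfV ?scale1r.
apply: (@critical_in_ED_fiber _ _ l).
- have [j _] : exists j : I, true.
    by move/card_gt0P: I_gt0 => [j _]; exists j.
  apply: contraNneq (part0 j) => x0.
  by rewrite /part Pu x0 mulmx0 scaler0 bilinear0l.
- move: rl; rewrite rootE horner_critical_poly // mulf_eq0 => /orP[|/eqP //].
  rewrite prodf_seq_eq0 => /hasP[k _ /=].
  by rewrite expf_eq0 /= subr_eq0 (negPf (lb k)).
- apply: P_inj => k.
  by rewrite mulmxDr -scalemxAr P_pencil Pu scalerA scalerDl scale1r.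
Qed.

Lemma critical_pt_inj u : (0 < #|I|)%N -> generic_pt u ->
  injective (critical_pt u).
Proof.
move=> /card_gt0P[j _] [part0 _] l l' /(congr1 (mulmx (P j))).
rewrite !P_critical_pt => /eqP; rewrite -subr_eq0 -scalerBl scaler_eq0.
case/orP => [|/eqP Pu0].
  rewrite subr_eq0 => /eqP/invr_inj/addrI; exact: mulIf.
by have := part0 j; rewrite /part Pu0 bilinear0l eqxx.
Qed.

(** Distinct roots give distinct critical points, so the fiber has as many
    elements as the degree of a secular polynomial with simple roots. *)
Lemma ED_fiber_card u : (0 < #|I|)%N -> generic_pt u ->
    coprimep (critical_poly u) (critical_poly u)^`() ->
  has_card (ED_fiber Z (bilinear_form Q) u) (2 * (#|I| - 1)).
Proof.
move=> I_gt0 gu cop; have size_cp := size_secular b gu.2.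
have cp0 : critical_poly u != 0 by rewrite -size_poly_eq0 size_cp.
have [s [us sz_s mem_s]] := simple_roots cp0 cop.
exists [seq critical_pt u l | l <- s]; split.
- by rewrite map_inj_uniq //; apply: critical_pt_inj.
- by rewrite size_map sz_s size_cp.
- move=> x; rewrite ED_fiberP //; split=> [/mapP[l] | [l rl ->]].
    by rewrite mem_s => rl ->; exists l.
  by apply: map_f; rewrite mem_s.
Qed.

Definition dual_poly : {mpoly K[n]} := \sum_j (a j)^-1 *: part_poly j.

(** The secular polynomial for indeterminate data; its specialisation at [u] is
    [critical_poly u]. *)
Definition universal_poly : {poly {mpoly K[n]}} :=
  \sum_j ((a j)^-1 *: part_poly j) *: map_poly (@mpolyC n K) (cofactor_sq b j).

Let ev u : {rmorphism {mpoly K[n]} -> K} := meval (fun i => u i 0).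

Lemma peval_dual u : peval dual_poly u = dual u.
Proof.
rewrite /peval raddf_sum; apply: eq_bigr => j _.
by rewrite /= mevalZ -/(peval _ u) peval_part mulrC.
Qed.

Lemma universal_polyE u : map_poly (ev u) universal_poly = critical_poly u.
Proof.
rewrite raddf_sum; apply: eq_bigr => j _ /=.
rewrite map_polyZ /= mevalZ -/(peval _ u) peval_part mulrC; congr (_ *: _).
by apply/polyP => i; rewrite !coef_map /= mevalC.
Qed.

(** Specialisation can only lower the degree, and it does not at this [u]. *)
Lemma size_universal u : dual u != 0 ->
  size universal_poly = (2 * (#|I| - 1)).+1.
Proof.
move=> du; apply/eqP; rewrite eqn_leq; apply/andP; split.
  apply: (leq_trans (size_sum _ _ _)); apply/bigmax_leqP => j _.
  apply: (leq_trans (size_scale_leq _ _)).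
  by apply: (leq_trans (size_poly _ _)); rewrite size_cofactor_sq.
by rewrite -(size_secular b du) -/(critical_poly u) -universal_polyE size_poly.
Qed.

Definition discriminant := resultant universal_poly universal_poly^`().

Lemma peval_discriminant u : dual u != 0 ->
  peval discriminant u = resultant (critical_poly u) (critical_poly u)^`().
Proof.
move=> du; have size_cp := size_secular b du.
have size_up := size_universal du.
have -> : peval discriminant u = ev u discriminant by [].
rewrite /discriminant resultant_map -?deriv_map universal_polyE //.
  by rewrite size_cp size_up.
have size_dcp : size (critical_poly u)^`() = (2 * (#|I| - 1))%N.
  by rewrite size_deriv_num size_cp.
apply/eqP; rewrite eqn_leq -{1}universal_polyE deriv_map size_poly.
rewrite size_dcp -ltnS -size_up lt_size_deriv //.
by rewrite -size_poly_eq0 size_up.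
Qed.

(** Combining the vectors [e j] with square roots as coefficients realises any
    prescribed weights of the secular polynomial. *)
Lemma exists_generic_coprime : (1 < #|I|)%N -> exists u,
  dual u != 0 /\ coprimep (critical_poly u) (critical_poly u)^`().
Proof.
move=> I_gt1; have [w [w_sum w_cop]] := exists_coprime_secular b_inj I_gt1.
pose N j := bilinear_form Q (e j) (e j).
(* The coefficients are chosen such that [part j u = w j * a j]. *)
pose u := \sum_j sqrtC (w j * a j / N j) *: e j.
have wE j : part j u / a j = w j.
  rewrite /part P_combination // !bilinearE -/(N j) mulrA -expr2 sqrtCK.
  by rewrite divfK ?mulfK ?e_anisotropic.
have cE : critical_poly u = secular b w.
  by apply: eq_bigr => j _; rewrite wE.
by exists u; rewrite cE; split=> //; rewrite /dual (eq_bigr _ (fun j _ => wE j)).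
Qed.

Definition generic_poly : {mpoly K[n]} :=
  dual_poly * discriminant * \prod_j part_poly j.

Lemma generic_poly_neq0 : (1 < #|I|)%N -> generic_poly != 0.
Proof.
have peval_neq0 (p : {mpoly K[n]}) u : peval p u != 0 -> p != 0.
  by apply: contraNneq => ->; rewrite /peval meval0.
move=> I_gt1; have [u [du cu]] := exists_generic_coprime I_gt1.
rewrite !mulf_neq0 //.
- by apply: (peval_neq0 _ u); rewrite peval_dual.
- apply: (peval_neq0 _ u); rewrite peval_discriminant // resultant_eq0.
  by rewrite -leqNgt (eqP cu).
- rewrite prodf_seq_neq0; apply/allP => j _ /=.
  by apply: (peval_neq0 _ (e j)); rewrite peval_part /part P_e.
Qed.

Lemma peval_generic_poly u : peval generic_poly u != 0 ->
  generic_pt u /\ coprimep (critical_poly u) (critical_poly u)^`().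
Proof.
rewrite /peval !mevalM -!/(peval _ u) peval_dual !mulf_eq0 !negb_or.
rewrite /peval rmorph_prod prodf_seq_neq0 -/(peval _ u).
move=> /andP[/andP[du discu] /allP partu]; split.
  split=> // j; have := partu j (mem_index_enum j).
  by rewrite /= -/(peval _ u) peval_part.
rewrite peval_discriminant // resultant_eq0 -leqNgt in discu.
rewrite /coprimep eqn_leq discu size_poly_gt0 gcdp_eq0 negb_and.
by rewrite -size_poly_eq0 size_secular.
Qed.

Lemma generically_ED_fiber_card : (1 < #|I|)%N ->
  generically (fun u =>
    has_card (ED_fiber Z (bilinear_form Q) u) (2 * (#|I| - 1))).
Proof.
move=> I_gt1; exists generic_poly; first exact: generic_poly_neq0.
move=> u /peval_generic_poly[gu cu].
exact: ED_fiber_card (ltnW I_gt1) gu cu.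
Qed.

(** A polynomial that vanishes on all data with a critical point vanishes
    wherever the genericity polynomial does not, so their product is zero. *)
Lemma ED_dominant_quadric : (1 < #|I|)%N -> ED_dominant Z (bilinear_form Q).
Proof.
move=> I_gt1 u p p0; have [g g0 card_fib] := generically_ED_fiber_card I_gt1.
suff: g * p = 0.
  by move/eqP; rewrite mulf_eq0 (negPf g0) => /eqP ->; rewrite /peval meval0.
apply: peval_inj0 => y; rewrite /peval mevalM -!/(peval _ y).
have [->|gy] := eqVneq (peval g y) 0; first by rewrite mul0r.
rewrite p0 ?mulr0 //; have [[|x s] [_ sz_s mem_s]] := card_fib y gy.
  by move: I_gt1 sz_s; rewrite -subn_gt0; case: (_ - _)%N.
by exists x; apply/mem_s; rewrite mem_head.
Qed.

(** With one eigenvalue, [u = (1 + l a) x] for every pair of the incidence set,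
    so that [u] itself lies on the cone, whereas [e i0] does not. *)
Lemma ED_not_dominant : #|I| = 1%N -> ~ ED_dominant Z (bilinear_form Q).
Proof.
move=> I1 dom; have /fintype1P[i0 all_i0] := introT eqP I1.
have sum_i0 (c : I -> K) : \sum_j c j = c i0.
  by rewrite (bigD1 i0) //= big1 ?addr0 // => j; rewrite (all_i0 j) eqxx.
have /eqP[] : form (e i0) != 0 by rewrite form_parts sum_i0 /part P_e mulf_neq0.
rewrite /form -peval_quadratic; apply: dom => u [x].
pose V : 'M[K]_(n, n + n) := row_mx 0 1%:M.
have VE z : V *m z = dsubmx z.
  by rewrite -{1}[z]vsubmxK mul_row_col mul1mx mul0mx add0r.
move/(_ (quadratic_form (V^T *m A *m V))).
rewrite !peval_quadratic bilinear_congr VE col_mxKd; apply => z [[Zz _] nz].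
have [l zl] := (normal_quadricP n_gt1 symA unitA symQ unitQ _ Zz).1 nz.
move: Zz; rewrite /Z /affine_cone !peval_quadratic -/(form _) => Fz.
rewrite bilinear_congr VE -/(form _) -[dsubmx z](subrK (usubmx z)) zl addrC.
move: Fz; rewrite !form_parts !sum_i0 part_spectral_line mulrCA => ->.
by rewrite mulr0.
Qed.

Lemma EDdegree_quadric : (0 < #|I|)%N ->
  EDdegree_is Z (bilinear_form Q) (2 * (#|I| - 1)).
Proof.
rewrite leq_eqVlt eq_sym => /predU1P[I1|I_gt1].
  by right; split; [exact: ED_not_dominant | rewrite I1].
by left; split; [exact: ED_dominant_quadric
               | exact: generically_ED_fiber_card].
Qed.

End EDQuadric.

(** * Spectral theory of a real pencil *)

Section SpectralProjectors.
Variables (K : fieldType) (n : nat) (B : 'M[K]_n.+1) (I : finType) (a : I -> K).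
Hypothesis a_inj : injective a.
Hypothesis B_annihilated : horner_mx B (\prod_j ('X - (a j)%:P)) = 0.

(** Two polynomials with the same values at the eigenvalues differ by a multiple
    of the annihilating product. Every identity between spectral projectors
    below is therefore checked on values of interpolation polynomials. *)
Lemma horner_mx_eq_on_spectrum (p q : {poly K}) :
  (forall j, p.[a j] = q.[a j]) -> horner_mx B p = horner_mx B q.
Proof.
move=> pq; apply/eqP; rewrite -subr_eq0 -rmorphB /=; apply/eqP.
have : \prod_j ('X - (a j)%:P) %| p - q.
  rewrite -(big_map a xpredT (fun z => 'X - z%:P)).
  apply: uniq_roots_dvdp.
    by apply/allP => _ /mapP[j _ ->]; rewrite rootE !hornerE pq subrr.
  by rewrite uniq_rootsE map_inj_uniq // index_enum_uniq.
by case/dvdpP => c ->; rewrite rmorphM /= B_annihilated mulr0.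
Qed.

Definition lagrange j : {poly K} :=
  \prod_(k | k != j) ((a j - a k)^-1 *: ('X - (a k)%:P)).

Lemma horner_lagrange j k : (lagrange j).[a k] = (j == k)%:R.
Proof.
rewrite /lagrange horner_prod; have [->|jk] := eqVneq j k.
  apply: big1 => i ik; rewrite !hornerE mulVf //.
  by rewrite subr_eq0 (inj_eq a_inj) eq_sym.
by rewrite (bigD1 k) 1?eq_sym //= !hornerE subrr mulr0 mul0r.
Qed.

Definition projector j : 'M[K]_n.+1 := horner_mx B (lagrange j).

Lemma sum_lagrange (c : I -> K) k : (\sum_j c j *: lagrange j).[a k] = c k.
Proof.
rewrite horner_sum (bigD1 k) //= big1 => [|j jk].
  by rewrite hornerZ horner_lagrange eqxx mulr1 addr0.
by rewrite hornerZ horner_lagrange (negPf jk) mulr0.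
Qed.

Lemma sum_projector : \sum_j projector j = 1%:M.
Proof.
rewrite -[RHS](rmorph1 (horner_mx B)) -(raddf_sum (horner_mx B)).
apply: horner_mx_eq_on_spectrum => k; rewrite hornerE.
by have := sum_lagrange (fun=> 1) k; under eq_bigr do rewrite scale1r.
Qed.

Lemma projectorM j k : projector j *m projector k = (j == k)%:R *: projector j.
Proof.
rewrite -[LHS]/(_ * _) -rmorphM -linearZ.
apply: horner_mx_eq_on_spectrum => i; rewrite hornerM hornerZ !horner_lagrange.
by have [->|jk] := eqVneq j k; [case: eqP | case: eqP => [<-|]];
  rewrite ?mulr1 ?mul0r ?mulr0 // eq_sym (negPf jk) mulr0.
Qed.

Lemma spectral_decomposition : B = \sum_j a j *: projector j.
Proof.
under eq_bigr do rewrite /projector -linearZ /=.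
rewrite -(raddf_sum (horner_mx B)) -[LHS](horner_mx_X B).
by apply: horner_mx_eq_on_spectrum => k; rewrite hornerX sum_lagrange.
Qed.

Lemma projector_eigenvector j (v : 'cV[K]_n.+1) :
  B *m v = a j *: v -> projector j *m v = v.
Proof.
move=> Bv; have horner_v p : horner_mx B p *m v = p.[a j] *: v.
  elim/poly_ind: p => [|p c IH]; first by rewrite raddf0 mul0mx horner0 scale0r.
  rewrite rmorphD rmorphM /= horner_mx_X horner_mx_C mulmxDl -mulmxA Bv.
  by rewrite -scalemxAr IH mul_scalar_mx !hornerE scalerDl scalerA mulrC.
by rewrite horner_v horner_lagrange eqxx scale1r.
Qed.

End SpectralProjectors.

Lemma horner_mx_self_adjoint (K : fieldType) (n : nat) (Q B : 'M[K]_n.+1) p :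
    B^T *m Q = Q *m B -> (horner_mx B p)^T *m Q = Q *m horner_mx B p.
Proof.
move=> QB; elim/poly_ind: p => [|p c IH].
  by rewrite raddf0 linear0 mul0mx mulmx0.
have -> : p * 'X + c%:P = 'X * p + c%:P by rewrite mulrC.
rewrite rmorphD linearD /= horner_mx_C mulmxDl mulmxDr tr_scalar_mx.
rewrite scalar_mxC; congr (_ + _); rewrite mulrC rmorphM /= horner_mx_X trmx_mul.
rewrite -mulmxA IH mulmxA QB -mulmxA; congr (_ *m _).
by have := comm_mx_horner p (erefl (B *m B)).
Qed.

Section RealSpectrum.
Variables (R : realType) (n : nat) (Q : 'M[R]_n.+1).
Hypothesis posQ : positive_definite Q.

Lemma posdef_unitmx : Q \in unitmx.
Proof.
rewrite unitmxE unitfE; apply/negP => /det0P[v v0 vQ].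
have : v^T != 0 by rewrite -(inj_eq (@trmx_inj _ _ _)) trmxK linear0.
by move/posQ; rewrite /bilinear_form trmxK vQ mul0mx mxE ltxx.
Qed.

Lemma posdef_eq0 x : bilinear_form Q x x = 0 -> x = 0.
Proof. by move=> Qx; apply/eqP; apply: contraT => /posQ; rewrite Qx ltxx. Qed.

(** [Q(T x, T x) = Q(x, T^2 x) = 0], and [Q] is definite. *)
Lemma self_adjoint_sqr0 T : T^T *m Q = Q *m T -> T *m T = 0 -> T = 0.
Proof.
move=> QT TT; apply/matrixP => i j.
have /colP/(_ i) : T *m (delta_mx j 0 : 'cV_n.+1) = 0.
  apply: posdef_eq0.
  by rewrite bilinear_self_adjoint // mulmxA TT mul0mx bilinear0r.
by rewrite -colE !mxE.
Qed.

Lemma self_adjoint_nilpotent T k : T^T *m Q = Q *m T -> T ^+ k = 0 -> T = 0.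
Proof.
move=> QT; case: k => [/eqP|]; first by rewrite oner_eq0.
(* [T^(k+1)] is self-adjoint and its square is a multiple of [T^(k+2)]. *)
elim=> [|k IH] // Tk; apply: IH; apply: self_adjoint_sqr0.
  by have := horner_mx_self_adjoint 'X^(k.+1) QT; rewrite rmorphXn /= horner_mx_X.
by rewrite -[LHS]/(_ * _) -exprD addSnnS exprD Tk mulr0.
Qed.

Variable B : 'M[R]_n.+1.
Hypothesis B_adj : B^T *m Q = Q *m B.

(** Let [z = t + i s] and [T = B - t]. The real matrix [T^2 + s^2] is singular
    over the complex numbers, hence over the reals, and a real vector [x] in
    its kernel has [Q(T x, T x) = - s^2 Q(x, x)]. Positivity forces [s = 0],
    and then [T x = 0]. *)
Lemma real_eigenpair (z : R[i]) : eigenvalue (complexify B) z ->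
  exists t, z = t%:C%C /\ exists2 x : 'cV[R]_n.+1, x != 0 & B *m x = t *: x.
Proof.
case/eigenvalueP => v vB v0; pose t := complex.Re z; pose s := complex.Im z.
pose T := B - t%:M.
have T_adj : T^T *m Q = Q *m T.
  by rewrite linearB /= tr_scalar_mx mulmxBl mulmxBr B_adj scalar_mxC.
have vT : v *m complexify T = ('i%C * s%:C%C) *: v.
  rewrite /complexify map_mxB map_scalar_mx mulmxBr vB mul_mx_scalar -scalerBl.
  by rewrite {1}(complexE z) addrC addKr.
have : \det (T *m T + (s ^+ 2)%:M) = 0.
  apply: (fmorph_inj (real_complex R)); rewrite rmorph0 -det_map_mx.
  apply/eqP/det0P; exists v => //.
  rewrite map_mxD map_mxM map_scalar_mx mulmxDr mulmxA vT -scalemxAl vT scalerA.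
  rewrite mul_mx_scalar -scalerDl -expr2 exprMn sqr_i rmorphXn /=.
  by rewrite mulN1r addNr scale0r.
rewrite -det_tr => /eqP/det0P[w w0 wT]; pose x := w^T.
have x0 : x != 0 by rewrite -(inj_eq (@trmx_inj _ _ _)) trmxK linear0.
have Tx : T *m (T *m x) = - s ^+ 2 *: x.
  move/(congr1 trmx): wT; rewrite trmx_mul trmxK linear0 mulmxDl mul_scalar_mx.
  by rewrite -mulmxA scaleNr => /eqP; rewrite addr_eq0 => /eqP.
have QTx : bilinear_form Q (T *m x) (T *m x) = - (s ^+ 2 * bilinear_form Q x x).
  by rewrite bilinear_self_adjoint // Tx bilinearZr mulNr.
have form_ge0 y : 0 <= bilinear_form Q y y.
  by have [->|/posQ/ltW //] := eqVneq y 0; rewrite bilinear0l.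
have s0 : s = 0.
  apply/eqP; rewrite -sqrf_eq0 eq_le sqr_ge0 andbT.
  have := form_ge0 (T *m x); rewrite QTx oppr_ge0 pmulr_lle0 //.
  exact: posQ.
exists t; split; first by rewrite (complexE z) -/s -/t s0 mulr0 addr0.
exists x => //; apply/eqP; rewrite -subr_eq0 -mul_scalar_mx -mulmxBl -/T.
by apply/eqP/posdef_eq0; rewrite QTx s0 expr0n mul0r oppr0.
Qed.

(** Diagonalisability. By Cayley-Hamilton a power of the left-hand side is zero,
    since every root of the characteristic polynomial is some [a j]; and a
    self-adjoint nilpotent matrix is zero. *)
Lemma eigenvalues_annihilate (I : finType) (a : I -> R) :
    (forall z, eigenvalue (complexify B) z -> exists j, z = (a j)%:C%C) ->
  horner_mx B (\prod_j ('X - (a j)%:P)) = 0.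
Proof.
move=> eig_a; set p := \prod_j _.
have [s def_chi] := closed_field_poly_normal (char_poly (complexify B)).
have pz z : z \in s -> 'X - z%:P %| map_poly (real_complex R) p.
  move=> zs; have /eig_a[j ->] : eigenvalue (complexify B) z.
    rewrite eigenvalue_root_char def_chi rootZ ?root_prod_XsubC //.
    by rewrite lead_coef_eq0 monic_neq0 ?char_poly_monic.
  rewrite dvdp_XsubCl rootE horner_map /= horner_prod (bigD1 j) //= !hornerE.
  by rewrite subrr mul0r.
have chi_p : char_poly (complexify B) %| map_poly (real_complex R) (p ^+ size s).
  rewrite def_chi (monicP (char_poly_monic _)) scale1r rmorphXn /=.
  elim: (s) pz => [|z s' IH] pz; first by rewrite big_nil dvd1p.
  rewrite big_cons exprS dvdp_mul ?pz ?mem_head // IH // => y ys.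
  by rewrite pz // inE ys orbT.
apply: (@self_adjoint_nilpotent _ (size s)).
  exact: horner_mx_self_adjoint.
rewrite -rmorphXn; apply: (map_mx_inj (f := real_complex R)).
rewrite map_horner_mx /= map_mx0; case/dvdpP: chi_p => c ->.
by rewrite rmorphM /= Cayley_Hamilton mulr0.
Qed.

End RealSpectrum.

(** A vector in the kernel of [M] would be a singular point of the quadric. *)
Lemma smooth_quadric_unitmx (K : fieldType) (n : nat) (M : 'M[K]_n) :
  M^T = M -> smooth_hypersurface (quadratic_form M) -> M \in unitmx.
Proof.
move=> symM smM; rewrite unitmxE unitfE; apply/negP => /det0P[v v0 vM].
have x0 : v^T != 0 by rewrite -(inj_eq (@trmx_inj _ _ _)) trmxK linear0.
have := smM v^T x0; rewrite peval_quadratic /bilinear_form trmxK vM mul0mx mxE.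
by rewrite gradient_quadratic trmxK symM mulmxDr vM addr0 eqxx => /(_ erefl).
Qed.

Theorem proposition5p6 (R : realType) (N : nat) (hN : (0 < N)%N)
    (MF MQ : 'M[R]_N.+1)
    (symF : MF^T = MF) (symQ : MQ^T = MQ)
    (smoothF : smooth_hypersurface (quadratic_form (complexify MF)))
    (smoothQ : smooth_hypersurface (quadratic_form (complexify MQ)))
    (posQ : positive_definite MQ)
    (r : nat)
    (hr : has_card (fun a : R[i] => eigenvalue (complexify (invmx MQ *m MF)) a) r) :
  EDdegree_is (affine_cone (quadratic_form (complexify MF)))
              (bilinear_form (complexify MQ))
              (2 * (r - 1)).
Proof.
set A := complexify MF; set Q := complexify MQ.
have symA : A^T = A by rewrite /A /complexify map_trmx symF.
have symQ' : Q^T = Q by rewrite /Q /complexify map_trmx symQ.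
have unitA : A \in unitmx by exact: smooth_quadric_unitmx smoothF.
have unitMQ : MQ \in unitmx by exact: posdef_unitmx.
have unitQ : Q \in unitmx by rewrite map_unitmx.
pose B := invmx MQ *m MF.
have B_adj : B^T *m MQ = MQ *m B.
  rewrite /B trmx_mul symF trmx_inv symQ -mulmxA mulVmx // mulmx1.
  by rewrite mulmxA mulmxV // mul1mx.
have BE : complexify B = invmx Q *m A by rewrite /complexify map_mxM map_invmx.
case: hr => s [us sz_s mem_s].
have eig_real z : z \in s -> exists t : R, z = t%:C%C /\
    exists2 x : 'cV[R]_N.+1, x != 0 & B *m x = t *: x.
  by move/mem_s; move/(real_eigenpair posQ B_adj).
pose I := 'I_r; pose aR (j : I) := complex.Re (nth 0 s j).
pose a (j : I) : R[i] := (aR j)%:C%C.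
have nth_s (j : I) : nth 0 s j \in s by rewrite mem_nth ?sz_s.
have aE j : a j = nth 0 s j.
  by rewrite /a /aR; have [t [-> _]] := eig_real _ (nth_s j).
have a_inj : injective a.
  move=> j k; rewrite !aE => /eqP.
  by rewrite nth_uniq ?sz_s // => /eqP/val_inj.
have a_neq0 j : a j != 0.
  have : eigenvalue (complexify B) (a j) by rewrite aE; apply/mem_s.
  case/eigenvalueP => v vB v0; apply: contraNneq v0 => a0.
  move: vB; rewrite a0 scale0r => /(congr1 (mulmx^~ (invmx (complexify B)))).
  by rewrite mulmxK ?mul0mx ?BE ?unitmx_mul ?unitmx_inv ?unitQ // => ->.
have annR : horner_mx B (\prod_j ('X - (aR j)%:P)) = 0.
  apply: (eigenvalues_annihilate posQ B_adj) => z /mem_s zs.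
  have lt_z : (index z s < r)%N by rewrite -sz_s index_mem.
  by exists (Ordinal lt_z); rewrite -/(a _) aE nth_index.
have ann : horner_mx (complexify B) (\prod_j ('X - (a j)%:P)) = 0.
  have -> : \prod_j ('X - (a j)%:P)
          = map_poly (real_complex R) (\prod_j ('X - (aR j)%:P)).
    rewrite rmorph_prod; apply: eq_bigr => j _.
    by rewrite rmorphB /= map_polyX map_polyC.
  by rewrite -map_horner_mx /= annR map_mx0.
have eigvec j : exists x : 'cV[R]_N.+1, (x != 0) && (B *m x == aR j *: x).
  have [t [zt [x x0 Bx]]] := eig_real _ (nth_s j).
  by exists x; rewrite x0 /aR zt Bx /=.
pose x j := xchoose (eigvec j).
have x0 j : x j != 0 by have /andP[] := xchooseP (eigvec j).
have Bx j : B *m x j = aR j *: x j by have /andP[_ /eqP] := xchooseP (eigvec j).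
have r_gt0 : (0 < #|I|)%N.
  rewrite card_ord lt0n; apply/eqP => r0; move: annR.
  rewrite big1 => [|j]; last by have := ltn_ord j; rewrite [X in (_ < X)%N]r0.
  by rewrite rmorph1 => /eqP; rewrite oner_eq0.
have -> : (r - 1 = #|I| - 1)%N by rewrite card_ord.
apply: (@EDdegree_quadric _ _ A Q _ symA unitA symQ' unitQ I a
  (projector (complexify B) a) (fun j => complexify (x j))) => //.
- exact: sum_projector.
- exact: projectorM.
- move=> j; apply: horner_mx_self_adjoint.
  by rewrite /complexify map_trmx -!map_mxM B_adj.
- by rewrite -BE; exact: spectral_decomposition.
- move=> j; apply: projector_eigenvector => //.
  by rewrite /complexify -map_mxM Bx map_mxZ.
- move=> j; rewrite /bilinear_form /complexify map_trmx -!map_mxM mxE.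
  by rewrite fmorph_eq0 gt_eqF // posQ // x0.
Qed.
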